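(* Let $n,x,y,a$ be integers such that $x$ and $y$ are odd, $x\neq y$, $1\leq x,y\leq n$ and $1\leq a<n$. Let $d_x=\gcd(x,2n)$ and $d_y=\gcd(y,2n)$, and suppose that $\gcd(d_x,d_y)=1$. There exists a perfect matching $F$ of $K_{2n}$ such that $\ell(F)=\{x^{n-a},y^a\}$ if and only if both of the following conditions are satisfied: (1) $a$ is even or $a\geq d_x$; (2) $n-a$ is even or $n-a\geq d_y$.
   Context: For a positive integer $v$, $K_v$ denotes the complete graph on the vertex set $\{0,1,\ldots,v-1\}$. The length of an edge $\{u,w\}$ of $K_v$ is $\ell(u,w)=\min(|u-w|,\,v-|u-w|)$. For a subgraph $\Gamma$ of $K_v$, $\ell(\Gamma)$ is the list (multiset) of lengths of all edges of $\Gamma$, counted with multiplicity. A perfect matching of $K_{2n}$ is a set of $n$ pairwise disjoint edges covering all vertices. The notation $\{x^{b},y^{c}\}$ denotes the list containing $b$ copies of $x$ and $c$ copies of $y$. *)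

(* Defs.v *)
From mathcomp Require Import all_boot all_order all_algebra.

Set Implicit Arguments.
Unset Strict Implicit.
Unset Printing Implicit Defensive.

(* The vertex set of K_v is 'I_v; an edge is a two-element set of vertices, and
   a subgraph is given by its edge set. *)
Definition is_edge (v : nat) (e : {set 'I_v}) : bool := #|e| == 2.

Definition len (v u w : nat) : nat := minn `|u - w|%N (v - `|u - w|%N).

(* The default value 0 is never used on an edge. *)
Definition edge_len (v : nat) (e : {set 'I_v}) : nat :=
  if enum e is [:: u; w] then len v u w else 0.

(* Lists are compared as multisets, i.e. up to perm_eq. *)
Definition len_list (v : nat) (G : {set {set 'I_v}}) : seq nat :=
  [seq edge_len e | e <- enum G].

Definition perfect_matching (n : nat) (F : {set {set 'I_(2 * n)}}) : Prop :=
  [/\ forall e, e \in F -> is_edge e,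
      #|F| = n,
      forall e1 e2, e1 \in F -> e2 \in F -> e1 != e2 -> [disjoint e1 & e2]
    & cover F = [set: 'I_(2 * n)]].

Lemma lenC (v u w : nat) : len v u w = len v w u.
Proof. by rewrite /len distnC. Qed.

Lemma edge_len_set2 (v : nat) (u w : 'I_v) :
  u != w -> edge_len [set u; w] = len v u w.
Proof.
move=> neq_uw; rewrite /edge_len.
have: perm_eq (enum [set u; w]) [:: u; w].
  apply: uniq_perm; rewrite ?enum_uniq //= ?inE ?neq_uw //.
  by move=> z; rewrite mem_enum !inE.
case: (enum _) (enum_uniq [set u; w]) => [|p [|q [|r s]]] _ pe;
  try by move/perm_size: pe.
have [pin qin] : p \in [:: u; w] /\ q \in [:: u; w].
  by rewrite -!(perm_mem pe) !inE !eqxx orbT.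
have /= := perm_uniq pe; rewrite !inE neq_uw /= !andbT => neq_pq.
move: pin qin neq_pq; rewrite !inE => /orP[] /eqP-> /orP[] /eqP->;
  rewrite ?eqxx // => _; exact: lenC.
Qed.

(* Main.v *)
Require Import Defs.
From mathcomp Require Import all_boot all_order all_algebra zify ring.

(** Necessity.  The x-edges preserve the residue modulo d = gcd(x, 2n), while a
    y-edge moves it by y, a unit modulo d.  If fewer than d edges have length y,
    the cycle of residues can be cut at a place crossed by no y-edge; labelling
    the residues consecutively along the cut cycle, x-edges have an even label
    sum and y-edges an odd one.  As d divides n, the label is n-periodic, so the
    total is even, and hence so is the number a of y-edges.

    Sufficiency.  Send every even vertex 2i to one of 2i + x, 2i + y, 2i - x,
    2i - y.  The choice depends on the position of w i in Z/n, the circle being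
    cut into consecutive arcs R, U, L, D of lengths r, u, l, e.  If
    w x = u - e and w (y - x)/2 = e + l modulo n, these steps rearrange the arcs
    in the order R, D, L, U, so that the odd vertices are hit bijectively, with
    r + l edges of length x and u + e edges of length y.  It remains to find w,
    e <= a and l <= n - a solving the two congruences; for a <= n - a this is
    elementary, and the two lengths play symmetric roles.  When w is not a unit
    modulo n, the points with the same position form a fibre, which an endpoint
    of an arc may split. *)

Set Implicit Arguments.
Unset Strict Implicit.
Unset Printing Implicit Defensive.
Import GRing.Theory Num.Theory.

(** * Matchings that join even vertices to odd ones by prescribed steps *)

Lemma len_step (n i : nat) (s : int) :
  i < 2 * n -> `|s| <= n ->
  len (2 * n) i `|((i%:Z + s)%R %% Posz (2 * n))%Z| = `|s|.
Proof.
move=> lt_i le_s.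
have [v v_n s_v] : exists2 v : nat, v < 2 * n &
    ((i%:Z + s)%R = Posz v \/ (i%:Z + s)%R = (v%:Z + Posz (2 * n))%R \/
     (i%:Z + s)%R = (v%:Z - Posz (2 * n))%R).
  have [?|[?|?]] : ((i%:Z + s < 0) \/ (Posz (2 * n) <= i%:Z + s) \/
      (0 <= i%:Z + s < Posz (2 * n)))%R by lia.
  - by exists (absz (i%:Z + s + Posz (2 * n))%R); lia.
  - by exists (absz (i%:Z + s - Posz (2 * n))%R); lia.
  - by exists (absz (i%:Z + s)%R); lia.
have -> : (((i%:Z + s)%R %% Posz (2 * n))%Z = v)%R.
  by case: s_v => [->|[]->];
    rewrite ?modzDr -?[in LHS](modzDr (_ - _)%R) ?subrK ?modz_small //; lia.
rewrite /len; lia.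
Qed.

(** Odd steps lead from even to odd vertices, so distinct targets modulo 2n already make the n edges
    disjoint; they cover all vertices by counting. *)
Lemma matching_of_steps (n : nat) (step : nat -> int) :
  (forall i, i < n -> odd `|step i| && (`|step i| <= n)) ->
  (forall i j, i < n -> j < n ->
     (Posz (2 * n) %| (Posz (2 * i) + step i - (Posz (2 * j) + step j))%R)%Z ->
     i = j) ->
  exists F : {set {set 'I_(2 * n)}},
    perfect_matching F /\
    perm_eq (len_list F) [seq `|step i|%N | i <- iota 0 n].
Proof.
move=> step_odd step_inj.
have wP (i : 'I_n) : 2 * i < 2 * n by have := ltn_ord i; lia.
pose t (i : nat) : nat := `|((Posz (2 * i) + step i)%R %% (2 * n)%:Z)%Z|.
have bP (i : 'I_n) : t i < 2 * n by rewrite /t; have := ltn_ord i; lia.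
pose wht i := Ordinal (wP i); pose blk i := Ordinal (bP i).
have blk_odd i : odd (blk i).
  by rewrite /= /t; have := step_odd i (ltn_ord i); lia.
have wht_even i : ~~ odd (wht i) by rewrite /=; lia.
have wht_inj : injective wht by move=> i j [] ?; apply: val_inj => /=; lia.
have blk_inj : injective blk.
  move=> i j [] tij; apply/val_inj/(step_inj _ _ (ltn_ord i) (ltn_ord j)).
  have n_neq0 : (Posz (2 * n) != 0)%R by have := ltn_ord i; lia.
  move: tij => /(congr1 Posz); rewrite /t !gez0_abs ?modz_ge0 // => tij.
  by rewrite -eqz_mod_dvd; apply/eqP.
have wb i j : wht i != blk j.
  by apply/eqP => ij; have := wht_even i; rewrite ij blk_odd.
pose E i := [set wht i; blk i].
have E_inj : injective E.
  move=> i j ij; have : wht i \in E j by rewrite -ij !inE eqxx.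
  by rewrite !inE (negbTE (wb _ _)) orbF => /eqP/wht_inj.
pose F := [set E i | i : 'I_n].
have cardE i : #|E i| = 2 by rewrite cards2 wb.
have cardF : #|F| = n by rewrite card_imset // card_ord.
have disjF e1 e2 : e1 \in F -> e2 \in F -> e1 != e2 -> [disjoint e1 & e2].
  move=> /imsetP[i _ ->] /imsetP[j _ ->] neq.
  have ij : i != j by apply: contraNneq neq => ->.
  rewrite -setI_eq0; apply/eqP/setP => v; rewrite !inE; apply/negbTE/negP.
  case/andP=> /orP[]/eqP-> /orP[]; first by move/eqP/wht_inj/eqP; apply/negP.
  - by apply/negP; rewrite wb.
  - by rewrite eq_sym; apply/negP; rewrite wb.
  - by move/eqP/blk_inj/eqP; apply/negP.
exists F; split; first split=> //.
- by move=> e /imsetP[i _ ->]; rewrite /is_edge cardE.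
- have tI : trivIset F by apply/trivIsetP.
  apply/eqP; rewrite eqEcard subsetT cardsT card_ord /=.
  move/eqP: tI => <-; rewrite (eq_bigr (fun _ => 2)).
    by rewrite sum_nat_const cardF; lia.
  by move=> e /imsetP[i _ ->]; exact: cardE.
have pe : perm_eq (enum F) [seq E i | i <- enum 'I_n].
  apply: uniq_perm; first exact: enum_uniq.
    by rewrite map_inj_uniq //; exact: enum_uniq.
  move=> e; rewrite mem_enum; apply/imsetP/mapP => -[i _ ->];
  by exists i; rewrite ?mem_enum.
rewrite /len_list (perm_trans (perm_map _ pe)) // -map_comp -val_enum_ord.
rewrite -map_comp; apply/permP => p; congr (count p _).
apply: eq_map => i /=; rewrite edge_len_set2 ?wb //.
have /andP[_ le_n] := step_odd i (ltn_ord i).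
by have := len_step (wP i) le_n.
Qed.

(** * Necessity: the parity obstruction *)

Lemma len_mod (n d u w : nat) :
  d %| 2 * n -> u < 2 * n -> w < 2 * n ->
  w = u + len (2 * n) u w %[mod d] \/ u = w + len (2 * n) u w %[mod d].
Proof.
move=> d_2n lt_u lt_w; rewrite /len.
have [le_uw|lt_wu] := leqP u w; case: (leqP `|u - w| (2 * n - `|u - w|)) => _.
- by left; congr (_ %% _); lia.
- right; have -> : w + (2 * n - `|u - w|) = u + 2 * n by lia.
  by rewrite -modnDmr (eqP d_2n) addn0.
- by right; congr (_ %% _); lia.
- left; have -> : u + (2 * n - `|u - w|) = w + 2 * n by lia.
  by rewrite -modnDmr (eqP d_2n) addn0.
Qed.

(** This serves both conditions, the second after exchanging x with y and a with n - a. *)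
Lemma length_parity (n x y a : nat) (F : {set {set 'I_(2 * n)}}) :
  odd x -> x <> y -> coprime (gcdn x (2 * n)) y -> odd a ->
  perfect_matching F -> perm_eq (len_list F) (nseq (n - a) x ++ nseq a y) ->
  gcdn x (2 * n) <= a.
Proof.
move=> x_odd neq_xy; set d := gcdn x (2 * n) => co a_odd.
case=> [Fedge cardF Fdisj Fcover] Flen.
have d_x : d %| x by apply: dvdn_gcdl.
have d_2n : d %| 2 * n by apply: dvdn_gcdr.
have d_odd : odd d by apply: dvdn_odd d_x x_odd.
have d_n : d %| n by rewrite -(@Gauss_dvdr d 2) // coprime_sym coprime2n.
have d_gt0 : 0 < d by apply: odd_gt0.
rewrite leqNgt; apply/negP => lt_ad.
have [z zP] : exists z, z * y = 1 %[mod d].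
  have [z _] := Bezoutl y d_gt0; rewrite (eqP co) => /dvdnP[q zq].
  (* Bezout gives z y = -1 modulo d; multiplying by d - 1 corrects the sign. *)
  exists (d.-1 * z); apply/eqP; rewrite -(eqn_modDl (z * y)) -mulnA -mulSn.
  by rewrite prednK // modnMr addnC zq modnMl.
have coz : coprime d z.
  rewrite /coprime -dvdn1; have dz := dvdn_gcdl d z.
  have dzy : gcdn d z %| z * y by rewrite dvdn_mulr // dvdn_gcdr.
  have := congr1 (modn^~ (gcdn d z)) zP; rewrite !modn_dvdm // (eqP dzy).
  by move=> /esym/eqP.
(* For an edge of length y, [bad e] is the residue of the end reached by adding y. Since a < d, some
   residue [v0] is never reached; the cycle is cut there. The default 0 does not occur for edges of
   F. *)
pose bad (e : {set 'I_(2 * n)}) : 'I_d :=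
  let k := if enum e is [:: u; w] then
             (if w == u + y %[mod d] then val w else val u) else 0 in
  Ordinal (ltn_pmod k d_gt0).
pose Y := [set e in F | edge_len e == y].
have cardY : #|Y| = a.
  have /permP/(_ (pred1 y)) := Flen; rewrite count_cat !count_nseq /= eqxx.
  have /eqP/negbTE -> := neq_xy; rewrite mul0n mul1n add0n => <-.
  rewrite count_map -sum1_count big_enum_cond -sum1_card /=.
  by apply: eq_bigl => e; rewrite !inE.
have [v0 v0P] : exists v0, v0 \notin bad @: Y.
  apply/existsP; rewrite -negb_forall; apply: contraL lt_ad => /forallP all_in.
  rewrite -leqNgt -cardY (leq_trans _ (leq_imset_card bad Y)) //.
  by rewrite -{1}(card_ord d) -cardsT subset_leq_card //; apply/subsetP.
(* The label k of v satisfies v = v0 + k y modulo d. Adding y raises it by one, except on arrival at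
   [v0], where it wraps to 0. *)
pose lam v := ((v + (d - v0)) * z) %% d.
have lam_x u w : w = u %[mod d] -> lam w = lam u.
  by move=> uw; rewrite /lam -modnMml -modnDml uw modnDml modnMml.
have lam_y u w : w = u + y %[mod d] -> w %% d != v0 -> lam w = (lam u).+1.
  move=> uw w_v0.
  have lamS : lam w = (lam u).+1 %% d.
    rewrite /lam -modnMml -modnDml uw modnDml modnMml -addn1 modnDml.
    by rewrite addnAC mulnDl -modnDmr [y * z]mulnC zP modnDmr.
  have lam0 : lam w != 0.
    apply: contra w_v0; rewrite /lam -/(dvdn _ _) Gauss_dvdl //.
    have lt0 := ltn_ord v0; rewrite -{2}(modn_small lt0).
    rewrite addnBA ?(ltnW lt0) // -eqn_mod_dvd ?modnDr //.
    by rewrite (leq_trans (ltnW lt0)) ?leq_addl.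
  have : (lam u).+1 <= d by rewrite /lam ltn_pmod.
  rewrite leq_eqVlt => /orP[/eqP u_d|]; last by rewrite lamS => /modn_small.
  by move: lam0; rewrite lamS u_d modnn.
have sum_edge e : e \in F -> (\sum_(v in e) lam v) %% 2 = (edge_len e == y).
  move=> eF; have : size (enum e) = 2 by rewrite -cardE; apply/eqP/Fedge.
  have len_xy : edge_len e \in nseq (n - a) x ++ nseq a y.
    by rewrite -(perm_mem Flen) map_f ?mem_enum.
  have badP : edge_len e == y -> bad e != v0.
    move=> e_y; apply: contraNneq v0P => <-; apply: imset_f.
    by rewrite inE eF.
  rewrite -big_enum; move: badP len_xy; rewrite /bad /edge_len.
  case: (enum e) => [|u [|w []]] //= badP len_xy _.
  rewrite !big_cons big_nil /= addn0.
  have uw := len_mod d_2n (ltn_ord u) (ltn_ord w).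
  case: eqP badP => [len_y /(_ isT) badP|len_y _].
    rewrite len_y in uw.
    move: badP; case: ifP => [/eqP wu|/eqP wu] badP.
      by rewrite (lam_y u w) // addnS addnn -(addn1 _.*2) -muln2 modnMDl.
    case: uw => uw; first by case: wu.
    by rewrite (lam_y w u) // addSn addnn -(addn1 _.*2) -muln2 modnMDl.
  have len_x : len (2 * n) u w = x.
    by move: len_xy; rewrite mem_cat !mem_nseq => /orP[]/andP[_ /eqP].
  have -> : lam w = lam u; last by rewrite addnn -muln2 modnMl.
  rewrite len_x in uw.
  by case: uw => uw; [|symmetry]; apply: lam_x;
    rewrite uw -modnDmr (eqP d_x) addn0.
have tI : trivIset F by apply/trivIsetP.
have sumE : (\sum_(v : 'I_(2 * n)) lam v) %% 2 = a %% 2.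
  have -> : \sum_(v : 'I_(2 * n)) lam v = \sum_(v in cover F) lam v.
    by apply: eq_bigl => v; rewrite Fcover inE.
  rewrite big_trivIset //= -modn_summ (eq_bigr _ sum_edge).
  rewrite -big_mkcondr /= sum1_card -cardY; congr (_ %% _).
  by apply: eq_card => e; rewrite inE.
suff : ~~ odd (\sum_(v : 'I_(2 * n)) lam v).
  by rewrite -[odd _]negbK -eqb0; move: sumE; rewrite !modn2 a_odd; case: odd.
rewrite -(big_mkord xpredT lam) mul2n -addnn.
rewrite (@big_cat_nat _ _ _ n) ?leq_addr //=.
rewrite -{2}[n]add0n big_addn addnK.
rewrite [X in _ + X](eq_bigr lam); last first.
  by move=> v _; apply: lam_x; rewrite -modnDmr (eqP d_n) addn0.
by rewrite addnn odd_double.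
Qed.

(** * Solving the two congruences *)

(* The window [0, b] fills at least half of Z/n, so steps of s or of -(n - s),
   whichever is the smaller, cannot jump over it. *)
Lemma residue_walk (n a b v s : nat) :
  n = a + b -> a <= b -> v < n -> 0 < s < n ->
  exists e l (q : int),
    [/\ e <= a, l <= b & (v%:Z - e%:Z * s%:Z = l%:Z + q * n%:Z)%R].
Proof.
move=> n_ab le_ab lt_vn /andP[s_gt0 lt_sn].
have [le_vb|lt_bv] := leqP v b; first by exists 0, v, 0%R; split=> //; lia.
have [le_sb|lt_bs] := leqP s b.
  (* Here e is the ceiling of (v - b) / s, the first time the descending walk is at most b. For s >
     b the walk climbs by n - s until it reaches or passes n. *)
  have E := divn_eq (v - b + s - 1) s; have R := ltn_pmod (v - b + s - 1) s_gt0.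
  set e := _ %/ s in E; set rho := _ %% s in E R.
  have le_e : e <= v - b by nia.
  by exists e, (b + rho + 1 - s), 0%R; split; lia.
have t_gt0 : 0 < n - s by lia.
have E := divn_eq (n - v + (n - s) - 1) (n - s).
have R := ltn_pmod (n - v + (n - s) - 1) t_gt0.
set e := _ %/ (n - s) in E; set rho := _ %% (n - s) in E R.
have le_e : e <= n - v by nia.
by exists e, (n - s - 1 - rho), (1 - e%:Z)%R; split; lia.
Qed.

Lemma euclid_int (v : int) (N : nat) :
  0 < N -> exists (j : int) (l : nat), l < N /\ (v = j * N%:Z + l%:Z)%R.
Proof.
move=> N_gt0; exists (v %/ N)%Z, `|(v %% N)%Z|.
have N_neq0 : (N%:Z != 0)%R by lia.
rewrite gez0_abs ?modz_ge0 //; split; last exact: divz_eq.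
have := ltz_mod v N_neq0; have := modz_ge0 v N_neq0.
by case: (v %% N)%Z => // k; lia.
Qed.

(** These are the congruences of the arc exchange with u = a - e, whence u - e = a - 2e. *)
Lemma slope_exists (n a b x y : nat) (h : int) :
  n = a + b -> 0 < a -> a <= b -> odd x -> odd y -> y <= n ->
  (y%:Z = x%:Z + h * 2)%R -> coprime (gcdn x n) y ->
  ~~ odd a \/ gcdn x n <= a -> ~~ odd b \/ gcdn y n <= b ->
  exists (w : int) (e l : nat) (p q : int),
    [/\ e <= a, l <= b, (w * x%:Z = a%:Z - e%:Z * 2 + p * n%:Z)%R
      & (w * h = e%:Z + l%:Z + q * n%:Z)%R].
Proof.
move=> n_ab a_gt0 le_ab x_odd y_odd le_yn hE.
set d := gcdn x n => co cond_a cond_b.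
have n_gt0 : 0 < n by rewrite n_ab addn_gt0 a_gt0.
have d_odd : odd d by apply: dvdn_odd (dvdn_gcdl x n) x_odd.
have [al [be Bez]] := Bezoutz x n.
have {}Bez : (al * x%:Z + be * n%:Z = d%:Z)%R by rewrite Bez.
have /dvdnP[N nE] : d %| n by apply: dvdn_gcdr.
have /dvdnP[X xE] : d %| x by apply: dvdn_gcdl.
clearbody d.
(* The first congruence fixes w only modulo N = n / d; since N <= b, the second
   one can then be met with l the residue of w h - e modulo N. *)
have [d_gt2|d_le2] := ltnP 2 d.
  (* Solving for w requires d to divide a - 2e; the choice makes this difference 0 or d. *)
  have [e [c [le_e aE]]] : exists e c, e <= a /\ a = 2 * e + c * d.
    clear -cond_a d_odd.
    case: cond_a => [a_even|le_da].
      by exists a./2, 0; split; lia.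
    by case: (boolP (odd a)) => ?;
      [exists (a - d)./2, 1 | exists a./2, 0]; split; lia.
  have [s [t st]] := Bezoutz d y.
  have {}st : (s * d%:Z + t * y%:Z = 1)%R by rewrite st /gcdz /= (eqP co).
  have N_gt0 : 0 < N by case: N nE n_gt0 => // ->.
  have [j [l [lt_lN vE]]] := euclid_int (al * c%:Z * h - e%:Z)%R N_gt0.
  have le_Nb : N <= b.
    have : N * 3 <= N * d by rewrite leq_mul2l d_gt2 orbT.
    by clear -nE n_ab le_ab; lia.
  (* The correction 2 j t N changes w x by a multiple of n, and w h by j t N (y - x), which is j N
     modulo n because t y = 1 modulo d and d divides x. *)
  exists (al * c%:Z - j * (t * 2) * N%:Z)%R, e, l.
  exists (- c%:Z * be - j * (t * 2) * X%:Z)%R, (j * (X%:Z * t + s))%R.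
  have nZ : (n%:Z = N%:Z * d%:Z)%R by rewrite nE PoszM.
  have xZ : (x%:Z = X%:Z * d%:Z)%R by rewrite xE PoszM.
  split=> //; first by rewrite (leq_trans (ltnW lt_lN)).
  - have -> : (a%:Z = e%:Z * 2 + c%:Z * (al * x%:Z + be * n%:Z))%R.
      by rewrite Bez aE PoszD !PoszM mulrC.
    by rewrite nZ xZ; ring.
  - move: st; rewrite hE xZ => /(congr1 (fun z => j * N%:Z * z)%R) st.
    rewrite nZ; clear -st vE; lia.
have {}d1 : d = 1 by case: d d_odd d_le2 {co cond_a Bez nE xE} => [|[|[]]].
rewrite {}d1 in Bez; clear -n_ab a_gt0 le_ab y_odd le_yn hE cond_b n_gt0 Bez.
have [sg [s [lt_sn sE]]] := euclid_int (al * y%:Z)%R n_gt0.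
have [ta [v [lt_vn vE]]] := euclid_int (al * a%:Z * h)%R n_gt0.
(* With w = al (a - 2e) and 2h = y - x, one gets w h = v - e s + e modulo n, so the e on the right
   cancels and a walk from v by steps -s remains. *)
suff [e [l [q [le_e le_l elq]]]] : exists e l (q : int),
    [/\ e <= a, l <= b & (v%:Z - e%:Z * s%:Z = l%:Z + q * n%:Z)%R].
  exists (al * (a%:Z - e%:Z * 2))%R, e, l.
  exists (- (a%:Z - e%:Z * 2) * be)%R, (ta + q - e%:Z * (sg + be))%R.
  split=> //.
    by have := congr1 (fun z => (a%:Z - e%:Z * 2) * z)%R Bez; clear; lia.
  have sE' := congr1 (fun z => e%:Z * z)%R sE.
  have Bez' := congr1 (fun z => e%:Z * z)%R Bez.
  rewrite hE in sE'; clear -vE elq sE' Bez'; lia.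
(* When y = n the walk does not move, but b is then even and v = b / 2. *)
have [s0|s_gt0] := posnP s; last by apply: residue_walk; rewrite ?s_gt0.
have y_n : y = n.
  have yE : (y%:Z = (sg * x%:Z + be * y%:Z) * n%:Z)%R.
    rewrite s0 addr0 in sE.
    have sE' := congr1 (fun z => x%:Z * z)%R sE.
    have Bez' := congr1 (fun z => y%:Z * z)%R Bez.
    clear -sE' Bez'; lia.
  have : (Posz n %| Posz y)%Z.
    by apply/dvdzP; exists (sg * x%:Z + be * y%:Z)%R.
  rewrite dvdzE /= => /dvdn_leq le_ny.
  by apply/eqP; rewrite eqn_leq le_yn le_ny ?odd_gt0.
have b_even : ~~ odd b.
  case: cond_b => //; rewrite y_n gcdnn n_ab leqNgt.
  by rewrite -[X in X < _]add0n ltn_add2r a_gt0.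
exists 0, b./2, 0%R; split=> //; first by clear; lia.
have vE2 : ((v%:Z * 2 - b%:Z) = (a%:Z * (sg + be) - ta * 2 - 1) * n%:Z)%R.
  have Bez' := congr1 (fun z => a%:Z * z)%R Bez.
  have sE' := congr1 (fun z => a%:Z * z)%R sE.
  have bZ : (b%:Z = n%:Z - a%:Z)%R by clear -n_ab; lia.
  rewrite hE s0 in sE'; rewrite bZ; clear -vE sE' Bez'; lia.
set c := (a%:Z * _ - _ - _)%R in vE2; clearbody c; rewrite y_n in y_odd.
(* The value 2v - b = c n lies strictly between -n and 2n, and c = 1 is excluded by parity, n being
   odd and b even. *)
have c0 : (c = 0)%R.
  have : (-1 < c)%R by clear -vE2 n_ab a_gt0 lt_vn; nia.
  have : (c < 2)%R by clear -vE2 n_ab a_gt0 lt_vn; nia.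
  have : c != 1%R by apply/eqP => c1; clear -c1 vE2 b_even y_odd; lia.
  by clear; lia.
clear -c0 vE2 b_even; lia.
Qed.

(** * Counting steps and exchanging four arcs of the circle Z/n *)

Lemma perm_two_values (T : Type) (U : eqType) (P : pred T) (x y : U)
    (s : seq T) :
  perm_eq [seq if P i then x else y | i <- s]
          (nseq (count P s) x ++ nseq (count (predC P) s) y).
Proof.
elim: s => //= i s IH; case: (P i) => /=; first by rewrite perm_cons.
rewrite perm_sym -cat1s perm_sym.
by rewrite (perm_trans _ (permEl (perm_catCA [:: y] _ _))) // perm_cons.
Qed.

(** Such an [f] permutes [0, n), so values may be counted instead of arguments. *)
Lemma count_itv_inj (n s t : nat) (f : nat -> nat) :
  (forall i, i < n -> f i < n) ->
  (forall i j, i < n -> j < n -> f i = f j -> i = j) -> s + t <= n ->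
  count (fun i => s <= f i < s + t) (iota 0 n) = t.
Proof.
move=> f_lt f_inj le_st.
have f_uniq : uniq (map f (iota 0 n)).
  rewrite map_inj_in_uniq ?iota_uniq // => i j.
  by rewrite !mem_iota /= !add0n => ? ?; apply: f_inj.
have /permP f_perm : perm_eq (map f (iota 0 n)) (iota 0 n).
  apply: uniq_perm; rewrite ?iota_uniq //.
  have sub : {subset map f (iota 0 n) <= iota 0 n}.
    by move=> _ /mapP[i + ->]; rewrite !mem_iota /= !add0n => /f_lt.
  by case: (uniq_min_size f_uniq sub); rewrite ?size_map // => _ E k; rewrite E.
rewrite -(count_map f (fun k => s <= k < s + t)) f_perm.
have -> : n = s + (t + (n - s - t)) by lia.
rewrite !iotaD !count_cat !add0n.
rewrite (@eq_in_count _ _ pred0); last by move=> k; rewrite mem_iota /=; lia.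
rewrite count_pred0 (@eq_in_count _ _ predT); last first.
  by move=> k; rewrite mem_iota.
rewrite count_predT size_iota add0n.
rewrite [X in _ + X](@eq_in_count _ _ pred0) ?count_pred0 //.
  by rewrite addn0.
by move=> k; rewrite mem_iota /=; lia.
Qed.

(* For n = m g and w prime to m, the fibre of resid w m over each residue has g
   points, which layer n m numbers from 0 to g - 1. *)
Definition resid (w : int) (m : nat) (z : int) : int := ((w * z)%R %% m)%Z.
Definition layer (n m : nat) (z : int) : int := ((z %% n)%Z %/ m)%Z.

Lemma resid_range (w z : int) (m : nat) :
  0 < m -> (0 <= resid w m z)%R /\ (resid w m z < m%:Z)%R.
Proof. by move=> m_gt0; rewrite modz_ge0 ?ltz_pmod //; lia. Qed.

Lemma layer_range (n m g : nat) (z : int) :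
  n = m * g -> 0 < n -> (0 <= layer n m z)%R /\ (layer n m z < g%:Z)%R.
Proof.
move=> nE n_gt0; have m_gt0 : 0 < m by case: m nE n_gt0 => // ->.
have [j [v [lt_v ->]]] := euclid_int z n_gt0.
rewrite /layer modzMDl modz_small; last by lia.
rewrite divz_nat; split=> //.
by rewrite ltz_nat ltn_divLR // mulnC -nE.
Qed.

Lemma layerMD (n m : nat) (z k : int) :
  layer n m (z + k * n%:Z)%R = layer n m z.
Proof. by rewrite /layer addrC modzMDl. Qed.

(** As w is a unit modulo m, the residue fixes z modulo m; the layer supplies the quotient by m of z
    modulo n. *)
Lemma resid_layer_inj (n m g : nat) (w z z' : int) :
  n = m * g -> 0 < n -> coprimez w m -> resid w m z = resid w m z' ->
  layer n m z = layer n m z' -> (Posz n %| (z - z')%R)%Z.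
Proof.
move=> nE n_gt0 co /eqP; rewrite eqz_mod_dvd -mulrBr Gauss_dvdzr; last first.
  by rewrite coprimez_sym.
rewrite -!eqz_mod_dvd => zz' lay.
have m_n : (Posz m %| Posz n)%Z by rewrite nE PoszM dvdz_mulr.
have modm v : ((v %% n)%Z %% m)%Z = (v %% m)%Z.
  apply/eqP; rewrite eqz_mod_dvd (dvdz_trans m_n) // -eqz_mod_dvd.
  by rewrite modz_mod.
rewrite (divz_eq (z %% n)%Z m) (divz_eq (z' %% n)%Z m).
by rewrite -/(layer n m z) lay !modm (eqP zz').
Qed.

Lemma ltn_lex (g k t r rho : nat) :
  t < g -> rho < g ->
  (k * g + t < r * g + rho) = (k < r) || (k == r) && (t < rho).
Proof. by move=> *; case: (ltngtP k r) => [?|?|->] /=; nia. Qed.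

(* Here r, u, l, e count fibres; the arcs have lengths r g + rho, u g - rho,
   l g + rho and e g - rho.  In the fibre split between R and U, and in the one
   split between L and D, the first rho points take the horizontal step; the
   second fibre is numbered through its translation by c = (x + y)/2 from the
   first, so that each pair of split points spans a square
   {v, v + x, v + y, v + x + y} of the graph and the choices agree. *)
Lemma exchange_matching (n m g r u l e rho x y : nat) (w h p q : int) :
  n = m * g -> m = r + u + l + e -> rho < g ->
  (0 < rho -> 0 < u /\ 0 < e) -> coprimez w m ->
  odd x -> odd y -> x <= n -> y <= n -> (y%:Z = x%:Z + h * 2)%R ->
  (w * x%:Z = u%:Z - e%:Z + p * m%:Z)%R -> (w * h = e%:Z + l%:Z + q * m%:Z)%R ->
  exists F : {set {set 'I_(2 * n)}}, perfect_matching F /\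
    perm_eq (len_list F)
      (nseq (r * g + rho + (l * g + rho)) x ++
       nseq (n - (r * g + rho + (l * g + rho))) y).
Proof.
move=> nE mE lt_rho rho_pos co x_odd y_odd le_x le_y hE wx wh.
have n_gt0 : 0 < n by rewrite (leq_trans (odd_gt0 x_odd)).
have m_gt0 : 0 < m by case: m nE n_gt0 {mE co wx wh} => // ->.
pose c := (x%:Z + h)%R.
have wc : (w * c = u%:Z + l%:Z + (p + q) * m%:Z)%R.
  by rewrite mulrDr wx wh; ring.
pose K (i : int) := resid w m i; pose T (i : int) := layer n m i.
have K_range (i : int) : (0 <= K i)%R /\ (K i < m%:Z)%R by apply: resid_range.
have T_range (i : int) : (0 <= T i)%R /\ (T i < g%:Z)%R by apply: layer_range.
pose isR i := ((K i < r%:Z) || (K i == r%:Z) && (T i < rho%:Z))%R.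
pose top := (r%:Z + u%:Z + l%:Z)%R.
pose isL i := ((r%:Z + u%:Z <= K i) &&
   ((K i < top) || (K i == top) && (T (i - c) < rho%:Z)))%R.
pose H i := isR i || isL i.
(* The step is x + 2 [off], giving x, y, -x, -y on R, U, L, D respectively. *)
pose off (i : int) : int := (if isR i then 0 else
  if K i < r%:Z + u%:Z then h else if isL i then - x%:Z else - c)%R.
have n_off (i j k : int) : (i + off i = j + off j + k * n%:Z)%R ->
    exists k', (i = j + k' * n%:Z)%R.
  (* [tgt] represents w [off] modulo m: the shifts that put the arcs in the order R, D, L, U. *)
  pose tgt (i : int) : int := (if isR i then 0 else
    if K i < r%:Z + u%:Z then e%:Z + l%:Z else
    if isL i then e%:Z - u%:Z else - (u%:Z + l%:Z))%R.
  have w_off v : exists q', (w * off v = tgt v + q' * m%:Z)%R.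
    rewrite /off /tgt; case: ifP => _.
      by exists 0%R; rewrite mulr0 mul0r addr0.
    case: ifP => _; first by exists q.
    case: ifP => _; first by exists (- p)%R; rewrite mulrN wx; ring.
    by exists (- (p + q))%R; rewrite mulrN wc; ring.
  (* Each arc is moved inside [0, m), so congruent images are equal. *)
  have tgt_range v : (0 <= K v + tgt v < m%:Z)%R.
    have [] := K_range v; have [] := T_range v; have [] := T_range (v - c)%R.
    rewrite /tgt /isR /isL /top; move: (K v) (T v) (T _) => Kv Tv Tc.
    by clear -mE rho_pos; do 3?[case: ifP] => *; lia.
  move=> ij; have tgt_eq : (K i + tgt i = K j + tgt j)%R.
    have [qi wi] := w_off i; have [qj wj] := w_off j.
    have iE := divz_eq (w * i)%R m; have jE := divz_eq (w * j)%R m.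
    rewrite -/(resid w m i) -/(K i) in iE.
    rewrite -/(resid w m j) -/(K j) in jE.
    have {}ij := congr1 (fun z => w * z)%R ij.
    rewrite nE PoszM !mulrDr wi wj iE jE in ij.
    rewrite -[LHS](@modz_small _ m) // -[RHS](@modz_small _ m) //.
    apply/eqP; rewrite eqz_mod_dvd; apply/dvdzP.
    exists ((w * j %/ m)%Z - (w * i %/ m)%Z + qj - qi + w * k * g%:Z)%R.
    move: ij; clear; lia.
  (* Different arcs share a target residue only for R and D, or U and L, at the two split fibres.
     Colliding points there would differ by c modulo n, and so have equal layers on opposite sides
     of [rho]. *)
  have Tij : (i = j - c + k * n%:Z -> T i = T (j - c))%R.
    by move=> ->; rewrite /T layerMD.
  have Tji : (j = i - c + (- k) * n%:Z -> T j = T (i - c))%R.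
    by move=> ->; rewrite /T layerMD.
  exists k; move: Tij Tji (K_range i) (K_range j) tgt_eq ij.
  move: (T_range i) (T_range (i - c)%R) (T_range j) (T_range (j - c)%R).
  rewrite /tgt /off /isR /isL /top /c.
  move: (K i) (T i) (T (i - _)%R) (K j) (T j) (T (j - _)%R).
  move=> Ki Ti Tic Kj Tj Tjc.
  clear -mE rho_pos hE.
  by do 3?[case: ifP => ?]; do 3?[case: ifP => ?]; move=> *; lia.
pose step (i : nat) : int := (x%:Z + off i * 2)%R.
have abs_step (i : nat) : `|step i| = if H i then x else y.
  have [] := K_range i; rewrite /step /off /H.
  rewrite /isL; case: (isR i) => /=; first by move=> *; lia.
  move: (K i) (_ || _) => Ki b; clear -hE; rewrite /c.
  by case: b; do 3?[case: ifP => ?]; move=> *; lia.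
have [i _|i j lt_i lt_j|F [FM Flen]] := @matching_of_steps n step.
- by rewrite abs_step; case: ifP => _; rewrite ?x_odd ?y_odd ?le_x ?le_y.
- move=> /dvdzP[k ijk]; have [|k' ij] := n_off i j k.
    by clear -ijk; rewrite /step in ijk; lia.
  have k'0 : k' = 0%R.
    have : (-1 < k')%R by clear -ij lt_i lt_j; nia.
    have : (k' < 1)%R by clear -ij lt_i lt_j; nia.
    by clear; lia.
  by clear -ij k'0; rewrite k'0 mul0r addr0 in ij; lia.
exists F; split=> //; apply: (perm_trans Flen).
rewrite (eq_map abs_step); apply: (perm_trans (perm_two_values _ _ _ _)).
suff countH :
    count (fun i : nat => H i) (iota 0 n) = r * g + rho + (l * g + rho).
  rewrite -countH -[X in nseq (X - _)](size_iota 0 n).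
  by rewrite -(count_predC (fun i : nat => H i)) addKn.
have code_lt k t : k < m -> t < g -> k * g + t < n.
  move=> lt_k lt_t; rewrite nE (leq_trans (_ : _ < k.+1 * g)) //.
    by rewrite mulSn addnC ltn_add2r.
  by rewrite leq_mul2r lt_k orbT.
have code_inj k t k' t' : t < g -> t' < g ->
    k * g + t = k' * g + t' -> k = k' /\ t = t'.
  move=> lt_t lt_t' E; have g_gt0 : 0 < g by rewrite (leq_trans _ lt_t).
  have := congr1 (divn^~ g) E; have := congr1 (modn^~ g) E.
  by rewrite !modnMDl !divnMDl // !modn_small // !divn_small // !addn0.
have Kn i : `|K i| < m by have := K_range i; lia.
have Tn i : `|T i| < g by have := T_range i; lia.
have KT_inj (c' : int) (i j : nat) : i < n -> j < n ->
    `|K i| * g + `|T (i%:Z - c')%R| = `|K j| * g + `|T (j%:Z - c')%R| -> i = j.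
  move=> lt_i lt_j /code_inj[] // Kij Tij.
  have {}Kij : K i = K j by have := K_range i; have := K_range j; lia.
  have {}Tij : T (i%:Z - c')%R = T (j%:Z - c')%R.
    by have := T_range (i%:Z - c')%R; have := T_range (j%:Z - c')%R; lia.
  have {}Kij : resid w m (i%:Z - c')%R = resid w m (j%:Z - c')%R.
    by rewrite /resid !mulrBr; apply/eqP; rewrite eqz_modDr; apply/eqP.
  have := resid_layer_inj nE n_gt0 co Kij Tij.
  rewrite opprB addrA subrK -eqz_mod_dvd.
  by rewrite !modz_small ?lez_nat ?ltz_nat // => /eqP[].
(* Under the code K g + T, R is an initial interval of [0, n); L is an interval once the layers are
   shifted by c. *)
have countR : count (fun i : nat => isR i) (iota 0 n) = r * g + rho.
  pose k1 (i : nat) := `|K i| * g + `|T (i%:Z - 0)%R|.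
  rewrite -(@count_itv_inj n 0 (r * g + rho) k1) => [|i _|i j|].
  - apply: eq_count => i; rewrite add0n /k1 ltn_lex // /isR subr0.
    by have := K_range i; have := T_range i; clear; lia.
  - exact: code_lt.
  - exact: KT_inj.
  - by clear -nE mE lt_rho rho_pos; nia.
have countL : count (fun i : nat => isL i) (iota 0 n) = l * g + rho.
  pose k2 (i : nat) := `|K i| * g + `|T (i%:Z - c)%R|.
  rewrite -(@count_itv_inj n ((r + u) * g) (l * g + rho) k2) => [|i _|i j|].
  - apply: eq_count => i; rewrite addnA -mulnDl /k2 ltn_lex // leqNgt.
    rewrite -[(r + u) * g]addn0 ltn_lex ?(leq_ltn_trans (leq0n rho) lt_rho) //.
    rewrite /isL /top.
    by have := K_range i; have := T_range (i%:Z - c)%R; clear; lia.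
  - exact: code_lt.
  - exact: KT_inj.
  - by clear -nE mE lt_rho rho_pos; nia.
rewrite -countR -countL -[RHS]count_predUI -[LHS]addn0; congr (_ + _).
rewrite (@eq_count _ _ pred0) ?count_pred0 // => i /=.
have := rho_pos; rewrite /isR /isL /top; have := T_range i.
by move: (K i) (T i) (T _); clear -rho_pos; lia.
Qed.

(** * From a solution of the congruences to the matching *)

Lemma gcdn_double (x n : nat) : odd x -> gcdn x (2 * n) = gcdn x n.
Proof. by move=> x_odd; rewrite Gauss_gcdr // coprime_sym coprime2n. Qed.

(** Dividing by g = gcd(w, n) makes w a unit modulo m = n / g. Since g divides u - e, e + l and n,
    the lengths r, u, l, e are rho, -rho, rho, -rho modulo g, the shape that the arc exchange
    requires. *)
Lemma matching_of_slope (n r u l e x y : nat) (w h p q : int) :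
  n = r + u + l + e -> odd x -> odd y -> x <= n -> y <= n ->
  (y%:Z = x%:Z + h * 2)%R -> (w * x%:Z = u%:Z - e%:Z + p * n%:Z)%R ->
  (w * h = e%:Z + l%:Z + q * n%:Z)%R ->
  exists F : {set {set 'I_(2 * n)}}, perfect_matching F /\
    perm_eq (len_list F) (nseq (r + l) x ++ nseq (u + e) y).
Proof.
move=> nE x_odd y_odd le_x le_y hE wx wh.
have n_gt0 : 0 < n by rewrite (leq_trans (odd_gt0 x_odd)).
pose g := gcdn `|w| n; have g_gt0 : 0 < g by rewrite gcdn_gt0 n_gt0 orbT.
have /dvdzP[w' wE] : (g%:Z %| w)%Z by rewrite dvdzE dvdn_gcdl.
have /dvdnP[m mE] : g %| n by rewrite dvdn_gcdr.
have co : coprimez w' m.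
  rewrite coprimezE /= /coprime -(eqn_pmul2r g_gt0) muln_gcdl mul1n -mE.
  by rewrite -[X in _ * X]/(absz (Posz g)) -abszM -wE.
clearbody g.
pose D := (w' * x%:Z - p * m%:Z)%R; pose E := (w' * h - q * m%:Z)%R.
have DE : (u%:Z - e%:Z = D * g%:Z)%R.
  by move: wx; rewrite wE mE PoszM /D; clear; lia.
have EE : (e%:Z + l%:Z = E * g%:Z)%R.
  by move: wh; rewrite wE mE PoszM /E; clear; lia.
have w'x : (w' * x%:Z = D + p * m%:Z)%R by rewrite subrK.
have w'h : (w' * h = E + q * m%:Z)%R by rewrite subrK.
clearbody D E.
pose rho := l %% g; have lt_rho : rho < g by rewrite ltn_pmod.
have lE := divn_eq l g; rewrite -/rho in lE; set l' := l %/ g in lE.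
clearbody l' rho.
pose e' := (E - l'%:Z)%R; pose u' := (D + e')%R.
pose r' := (m%:Z - u' - l'%:Z - e')%R.
have eE : (e%:Z = e' * g%:Z - rho%:Z)%R.
  by move: EE; rewrite /e' lE; clear; lia.
have uE : (u%:Z = u' * g%:Z - rho%:Z)%R.
  by move: DE; rewrite /u' eE; clear; lia.
have rE : (r%:Z = r' * g%:Z + rho%:Z)%R.
  have : (n%:Z = r%:Z + u%:Z + l%:Z + e%:Z)%R by rewrite nE !PoszD.
  by rewrite mE uE eE lE /r'; clear; lia.
have e'0 : (0 <= e')%R /\ ((0 < rho)%N -> 0 < e')%R by clear -eE g_gt0; nia.
have u'0 : (0 <= u')%R /\ ((0 < rho)%N -> 0 < u')%R by clear -uE g_gt0; nia.
have r'0 : (0 <= r')%R by clear -rE lt_rho; nia.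
have [F [FM Flen]] :=
  @exchange_matching n m g `|r'| `|u'| l' `|e'| rho x y w' h p q mE
  ltac:(clear -r'0 u'0 e'0; lia) lt_rho ltac:(clear -u'0 e'0; lia) co
  x_odd y_odd le_x le_y hE ltac:(rewrite w'x; clear -u'0 e'0; lia)
  ltac:(rewrite w'h; clear -e'0; lia).
exists F; split=> //; move: Flen.
have -> : `|r'| * g + rho = r by clear -r'0 rE; nia.
rewrite -lE; have -> // : n - (r + l) = u + e by clear -nE; lia.
Qed.

Lemma matching_exists (n x y a b : nat) :
  n = a + b -> 0 < a -> a <= b -> odd x -> odd y -> x <= n -> y <= n ->
  coprime (gcdn x n) y ->
  ~~ odd a \/ gcdn x n <= a -> ~~ odd b \/ gcdn y n <= b ->
  exists F : {set {set 'I_(2 * n)}},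
    perfect_matching F /\ perm_eq (len_list F) (nseq b x ++ nseq a y).
Proof.
move=> n_ab a_gt0 le_ab x_odd y_odd le_x le_y co cond_a cond_b.
have [h hE] : exists h, (y%:Z = x%:Z + h * 2)%R.
  by exists ((y%:Z - x%:Z) %/ 2)%Z; clear -x_odd y_odd; lia.
have [w [e [l [p [q [le_e le_l wx wh]]]]]] :=
  slope_exists n_ab a_gt0 le_ab x_odd y_odd le_y hE co cond_a cond_b.
have [|//|//|//|//|//||//|F [FM Flen]] :=
  @matching_of_slope n (b - l) (a - e) l e x y w h p q.
- by clear -n_ab le_e le_l; lia.
- by rewrite wx; clear -le_e; lia.
by exists F; split=> //; move: Flen; rewrite !subnK.
Qed.

Theorem theorem3p9 (n x y a : nat)
  (x_odd : odd x) (y_odd : odd y) (neq_xy : x <> y)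
  (x_range : 1 <= x <= n) (y_range : 1 <= y <= n) (a_range : 1 <= a < n)
  (dx_dy_coprime : gcdn (gcdn x (2 * n)) (gcdn y (2 * n)) = 1) :
  (exists F : {set {set 'I_(2 * n)}},
      perfect_matching F /\ perm_eq (len_list F) (nseq (n - a) x ++ nseq a y))
  <->
  (~~ odd a \/ gcdn x (2 * n) <= a) /\
  (~~ odd (n - a) \/ gcdn y (2 * n) <= n - a).
Proof.
have [[_ le_x] [_ le_y]] := (andP x_range, andP y_range).
have [a_gt0 lt_an] := andP a_range.
(* As dx divides 2n, gcd(dx, dy) equals gcd(dx, y). *)
have co_x : coprime (gcdn x (2 * n)) y.
  by apply/eqP; move: dx_dy_coprime; rewrite (gcdnC y) gcdnA -(gcdnA x) gcdnn.
have co_y : coprime (gcdn y (2 * n)) x.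
  apply/eqP; move: dx_dy_coprime.
  by rewrite gcdnC (gcdnC x) gcdnA -(gcdnA y) gcdnn.
split=> [[F [FM Flen]]|].
  split.
    case: (boolP (odd a)) => a_odd; [right|by left].
    exact: (length_parity x_odd neq_xy co_x a_odd FM Flen).
  case: (boolP (odd (n - a))) => na_odd; [right|by left].
  apply: (length_parity y_odd (nesym neq_xy) co_y na_odd FM).
  by rewrite subKn ?(ltnW lt_an) // (perm_trans Flen) // perm_catC.
rewrite !gcdn_double // in co_x co_y * => -[cond_a cond_b].
have [le_a|/ltnW le_na] := leqP a (n - a).
  by apply: matching_exists; rewrite ?subnKC // ltnW.
have [||||||||||F [FM Flen]] := @matching_exists n y x (n - a) a => //.
- by rewrite subnK // ltnW.
- by rewrite subn_gt0.
by exists F; split=> //; rewrite (perm_trans Flen) // perm_catC.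
Qed.
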